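(* Let $n\ge2$ and let $\mathcal D=(C_1,C_2,\dots,C_{n+2})$ be an oriented Descartes configuration in $\mathbb R^n$. Then the dual spheres $C_1^\perp,\dots,C_{n+2}^\perp$ can be oriented so that the resulting oriented dual configuration $(C_1^\perp,C_2^\perp,\dots,C_{n+2}^\perp)$ is equiseparated, with $$\Delta(C_j^\perp,C_k^\perp)=\frac{1}{n-1}\qquad\text{if } j\neq k .$$
   Context: ''Sphere'' means an $(n-1)$-sphere in $\mathbb R^n$, hyperplanes being allowed as degenerate spheres (passing through $\infty$). An oriented sphere is a sphere with a chosen direction of unit normal (inward or outward); its interior is the usual interior for the inward normal and the exterior for the outward normal. The interior of an oriented hyperplane is the open half-space into which its chosen unit normal points. A Descartes configuration in $\mathbb R^n$ consists of $n+2$ pairwise tangent spheres with all points of tangency distinct (parallel hyperplanes are tangent at $\infty$). It is oriented if its spheres are oriented so that either the interiors of all $n+2$ oriented spheres are pairwise disjoint, or they are pairwise disjoint after reversing all orientations. Known fact: for each $j$ there is a unique sphere $C_j^\perp$ (possibly a hyperplane) passing through the $\frac{n(n+1)}2$ tangency points of the $n+1$ mutually tangent spheres $\{C_i:i\ne j\}$ (a sphere passes through $\infty$ iff it is a hyperplane); it is orthogonal to each of these $n+1$ spheres. These $C_j^\perp$ are the dual spheres. The separation $\Delta(C_1,C_2)$ of two oriented spheres is defined as follows. (i) If both have finite radii $r_1,r_2>0$ and centers at distance $d$, then $\Delta(C_1,C_2)=\frac{d^2-r_1^2-r_2^2}{2r_1r_2}$ if both are inwardly oriented or both outwardly oriented,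 and the negative of this otherwise. (ii) If $C_1$ has finite radius $r_1$ and $C_2$ is a hyperplane, then $\Delta(C_1,C_2)=d/r_1$, where $d$ is the signed distance from the center $\mathbf x_1$ of $C_1$ to $C_2$, with $d\ge0$ if $\mathbf x_1$ is not in the interior of $C_2$ and $C_1$ is inwardly oriented, or if $\mathbf x_1$ is in the interior of $C_2$ and $C_1$ is outwardly oriented, and $d<0$ otherwise ($\Delta$ is symmetric). (iii) If both are hyperplanes, $\Delta(C_1,C_2)=-\cos\theta$, where $\theta$ is the angle between their designated unit normals. A collection of oriented spheres is equiseparated if all the values $\Delta(C_j,C_k)$ with $j\ne k$ are equal. *)

(* Defs.v *)
From mathcomp Require Import all_boot all_order all_algebra.
From mathcomp Require Import classical_sets reals trigo.

Set Implicit Arguments.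
Unset Strict Implicit.
Unset Printing Implicit Defensive.

Import Order.TTheory GRing.Theory Num.Theory.

Local Open Scope classical_set_scope.
Local Open Scope ring_scope.

Section Spheres.
Context {R : realType} {n : nat}.
Implicit Types u v x : 'rV[R]_n.

Definition dot u v : R := \sum_i u 0 i * v 0 i.

(* Matrices carry the sup norm in the analysis library; the Euclidean norm is
   needed here. *)
Definition enorm v : R := Num.sqrt (dot v v).

Definition angle u v : R := acos (dot u v / (enorm u * enorm v)).

(* [OSphere c r inward _] has centre c and radius r; [inward] tells whether the
   chosen unit normal points inward.  [OPlane u b _] is the hyperplane
   <u, x> = b with chosen unit normal u. *)
Inductive osphere : Type :=
| OSphere (c : 'rV[R]_n) (r : R) (inward : bool) of 0 < r
| OPlane (u : 'rV[R]_n) (b : R) of enorm u = 1.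

Lemma enormN u : enorm (- u) = enorm u.
Proof.
by congr Num.sqrt; apply: eq_bigr => i _; rewrite !mxE mulrNN.
Qed.

Definition reverse (S : osphere) : osphere :=
  match S with
  | OSphere c r inward r_gt0 => OSphere c (~~ inward) r_gt0
  | OPlane u b u1 => OPlane (- b) (etrans (enormN u) u1)
  end.

(* The underlying unoriented sphere, as a set of points of the one-point
   compactification of R^n: [None] is the point at infinity. *)
Definition points (S : osphere) : set (option 'rV[R]_n) :=
  fun p => match S, p with
  | OSphere c r _ _, Some x => enorm (x - c) = r
  | OSphere _ _ _ _, None => False
  | OPlane u b _, Some x => dot u x = b
  | OPlane _ _ _, None => True
  end.

Definition interior (S : osphere) : set 'rV[R]_n :=
  match S with
  | OSphere c r true _ => [set x | enorm (x - c) < r]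
  | OSphere c r false _ => [set x | r < enorm (x - c)]
  | OPlane u b _ => [set x | b < dot u x]
  end.

(* For n >= 2, two spheres are tangent iff they have exactly one common point
   in the compactified space. *)
Definition tangent_at (S T : osphere) (p : option 'rV[R]_n) : Prop :=
  points S `&` points T = [set p].

Definition tangent (S T : osphere) : Prop := exists p, tangent_at S T p.

Definition descartes (C : 'I_n.+2 -> osphere) : Prop :=
  (forall i j, i != j -> tangent (C i) (C j)) /\
  (forall i j k l p q, i != j -> k != l -> [set i; j]%SET != [set k; l]%SET ->
     tangent_at (C i) (C j) p -> tangent_at (C k) (C l) q -> p <> q).

Definition disjoint_interiors (C : 'I_n.+2 -> osphere) : Prop :=
  forall i j, i != j -> interior (C i) `&` interior (C j) = set0.

Definition oriented_descartes (C : 'I_n.+2 -> osphere) : Prop :=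
  descartes C /\
  (disjoint_interiors C \/ disjoint_interiors (fun i => reverse (C i))).

Definition is_sphere (A : set (option 'rV[R]_n)) : Prop :=
  exists S : osphere, A = points S.

Definition through_tangencies (C : 'I_n.+2 -> osphere) (j : 'I_n.+2)
    (A : set (option 'rV[R]_n)) : Prop :=
  forall i k p, i != j -> k != j -> i != k -> tangent_at (C i) (C k) p -> A p.

Definition is_dual (C : 'I_n.+2 -> osphere) (j : 'I_n.+2) :
    set (option 'rV[R]_n) -> Prop :=
  unique (fun A => is_sphere A /\ through_tangencies C j A).

(* |<u, x> - b| is the distance from x to the hyperplane <u, x> = b, as u is a
   unit vector, and b < <u, x> says that x lies in its interior. *)
Definition signed_dist (inward : bool) x u (b : R) : R :=
  let d := `|dot u x - b| in
  if (if inward then ~~ (b < dot u x) else b < dot u x) then d else - d.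

Definition separation (S T : osphere) : R :=
  match S, T with
  | OSphere c1 r1 in1 _, OSphere c2 r2 in2 _ =>
      let s := (enorm (c1 - c2) ^+ 2 - r1 ^+ 2 - r2 ^+ 2) / (2 * r1 * r2) in
      if in1 == in2 then s else - s
  | OSphere c r inward _, OPlane u b _
  | OPlane u b _, OSphere c r inward _ => signed_dist inward c u b / r
  | OPlane u _ _, OPlane v _ _ => - cos (angle u v)
  end.

Definition equiseparated (C : 'I_n.+2 -> osphere) : Prop :=
  forall i j k l, i != j -> k != l ->
    separation (C i) (C j) = separation (C k) (C l).

End Spheres.

Arguments osphere : clear implicits.

(* Main.v *)
(* Oriented spheres correspond to the unit vectors of the Lorentz space
   R^(n+1,1), points of the compactified space to lightlike lines, incidence to
   orthogonality, and the separation is minus the Lorentz product. Two tangent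
   spheres with disjoint interiors have product -1, and their sum spans the
   lightlike line of the tangency point. Hence the vectors w_i of a Descartes
   configuration have Gram matrix 2I - J, so they form a basis; a sphere passes
   through the tangency points of the C_i with i <> j iff its vector is
   orthogonal to these w_i, i.e. is proportional to the j-th vector of the dual
   basis. The dual basis has Gram matrix (2I - J)^-1 = (I - J/n)/2, whose
   normalised off-diagonal entries are -1/(n-1). *)
Require Import Defs.
From mathcomp Require Import all_boot all_order all_algebra.
From mathcomp Require Import classical_sets reals trigo.
From mathcomp Require Import ring lra.

Set Implicit Arguments.
Unset Strict Implicit.
Unset Printing Implicit Defensive.

Import Order.TTheory GRing.Theory Num.Theory.

Local Open Scope ring_scope.

(** * Euclidean inner product *)

Section Dot.
Context {R : realType} {n : nat}.
Implicit Types (u v x y : 'rV[R]_n) (a b : R).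

Lemma dotC u v : dot u v = dot v u.
Proof. by apply: eq_bigr => i _; rewrite mulrC. Qed.

Lemma dotDl u v x : dot (u + v) x = dot u x + dot v x.
Proof. by rewrite -big_split; apply: eq_bigr => i _; rewrite mxE mulrDl. Qed.

Lemma dotZl a u x : dot (a *: u) x = a * dot u x.
Proof. by rewrite /dot mulr_sumr; apply: eq_bigr => i _; rewrite mxE mulrA. Qed.

Lemma dotNl u x : dot (- u) x = - dot u x.
Proof. by rewrite -scaleN1r dotZl mulN1r. Qed.

Lemma dot0l x : dot 0 x = 0.
Proof. by rewrite -(scale0r 0) dotZl mul0r. Qed.

Lemma dotDr x u v : dot x (u + v) = dot x u + dot x v.
Proof. by rewrite dotC dotDl !(dotC x). Qed.

Lemma dotZr a x u : dot x (a *: u) = a * dot x u.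
Proof. by rewrite dotC dotZl (dotC x). Qed.

Lemma dotNr x u : dot x (- u) = - dot x u.
Proof. by rewrite dotC dotNl (dotC x). Qed.

Lemma dot0r x : dot x 0 = 0.
Proof. by rewrite dotC dot0l. Qed.

Definition dotE := (dotDl, dotDr, dotZl, dotZr, dotNl, dotNr, dot0l, dot0r).

Lemma dot_mulmx u v : dot u v = (u *m v^T) 0 0.
Proof. by rewrite mxE; apply: eq_bigr => i _; rewrite mxE. Qed.

Lemma dot_ge0 u : 0 <= dot u u.
Proof. by apply: sumr_ge0 => i _; rewrite -expr2 sqr_ge0. Qed.

Lemma dot_eq0 u : (dot u u == 0) = (u == 0).
Proof.
apply/eqP/eqP => [|->]; last exact: dot0l.
move/psumr_eq0P => u0; apply/rowP => i; rewrite mxE; apply/eqP.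
by rewrite -sqrf_eq0 expr2 u0 // => j _; rewrite -expr2 sqr_ge0.
Qed.

Lemma enorm_sqr u : enorm u ^+ 2 = dot u u.
Proof. by rewrite sqr_sqrtr ?dot_ge0. Qed.

Lemma enorm_unit u : enorm u = 1 -> dot u u = 1.
Proof. by rewrite -enorm_sqr => ->; rewrite expr1n. Qed.

(** Equality case of Cauchy-Schwarz: here |u - v|^2 = 2 - 2 <u, v> = 0. *)
Lemma dot_unit_eq u v : dot u u = 1 -> dot v v = 1 -> dot u v = 1 -> u = v.
Proof.
move=> u1 v1 uv; apply/eqP; rewrite -subr_eq0 -dot_eq0 !dotE (dotC v).
by rewrite u1 v1 uv; apply/eqP; ring.
Qed.

Lemma dot_unit_bound u v : dot u u = 1 -> dot v v = 1 -> -1 <= dot u v <= 1.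
Proof.
move=> u1 v1; have := dot_ge0 (u + v); have := dot_ge0 (u - v).
by rewrite !dotE (dotC v u) u1 v1; lra.
Qed.

(** The Gram determinant 1 - g^2 of u and v is nonzero, so Cramer's rule gives a solution in their
    span: two non-parallel hyperplanes meet. *)
Lemma dot_unit_solve u v a b : dot u u = 1 -> dot v v = 1 ->
  dot u v != 1 -> dot u v != -1 -> exists z, dot u z = a /\ dot v z = b.
Proof.
move=> u1 v1; set g := dot u v; rewrite -subr_eq0 => g1.
rewrite -subr_eq0 opprK => g2; exists (((a - g * b) / ((1 - g) * (1 + g))) *: u
        + ((b - g * a) / ((1 - g) * (1 + g))) *: v).
have h1 : 1 - g != 0 by rewrite -oppr_eq0 opprB.
have h2 : 1 + g != 0 by rewrite addrC.
by rewrite !dotE (dotC v u) u1 v1 -/g; split; field; rewrite h1 h2.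
Qed.

End Dot.

(** * Lorentz space and its lightlike and unit vectors *)

Section Minkowski.
Context {R : realType} {n : nat}.
Implicit Types (m x y N : 'rV[R]_n) (U V W : 'rV[R]_(1 + (1 + n))) (a b c : R).

(* Coordinates (b, c, m) of a sphere with curvature b: m is b times the centre,
   and c is the curvature of its image under inversion in the unit sphere. *)
Definition lvec b c m : 'rV[R]_(1 + (1 + n)) := row_mx b%:M (row_mx c%:M m).
Definition curv U : R := lsubmx U 0 0.
Definition cocurv U : R := lsubmx (rsubmx U) 0 0.
Definition cen U : 'rV[R]_n := rsubmx (rsubmx U).

Lemma curvK b c m : curv (lvec b c m) = b.
Proof. by rewrite /curv row_mxKl mxE mulr1n. Qed.
Lemma cocurvK b c m : cocurv (lvec b c m) = c.
Proof. by rewrite /cocurv row_mxKr row_mxKl mxE mulr1n. Qed.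
Lemma cenK b c m : cen (lvec b c m) = m.
Proof. by rewrite /cen !row_mxKr. Qed.
Definition lvecK := (curvK, cocurvK, cenK).

Lemma lvec_eta U : lvec (curv U) (cocurv U) (cen U) = U.
Proof. by rewrite /lvec -!mx11_scalar !hsubmxK. Qed.

Lemma lvecD b c m b' c' m' :
  lvec b c m + lvec b' c' m' = lvec (b + b') (c + c') (m + m').
Proof. by rewrite /lvec !add_row_mx -!raddfD. Qed.

Lemma lvecZ a b c m : a *: lvec b c m = lvec (a * b) (a * c) (a *: m).
Proof. by rewrite /lvec !scale_row_mx !scale_scalar_mx. Qed.

(** Polarisation of |m|^2 - b c, a form with value 1 on the vectors of spheres and 0 on those of
    points. *)
Definition mink U V : R :=
  dot (cen U) (cen V) - (curv U * cocurv V + cocurv U * curv V) / 2.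

Lemma mink_lvec b c m b' c' m' :
  mink (lvec b c m) (lvec b' c' m') = dot m m' - (b * c' + c * b') / 2.
Proof. by rewrite /mink !lvecK. Qed.

Lemma minkC U V : mink U V = mink V U.
Proof. by rewrite /mink dotC; ring. Qed.

Lemma minkDl U V W : mink (U + V) W = mink U W + mink V W.
Proof.
rewrite -[U]lvec_eta -[V]lvec_eta -[W]lvec_eta lvecD !mink_lvec dotDl; ring.
Qed.

Lemma minkZl a U W : mink (a *: U) W = a * mink U W.
Proof.
rewrite -[U]lvec_eta -[W]lvec_eta lvecZ !mink_lvec dotZl; ring.
Qed.

Lemma minkDr W U V : mink W (U + V) = mink W U + mink W V.
Proof. by rewrite minkC minkDl !(minkC W). Qed.

Lemma minkZr a W U : mink W (a *: U) = a * mink W U.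
Proof. by rewrite minkC minkZl (minkC W). Qed.

Lemma minkNl U W : mink (- U) W = - mink U W.
Proof. by rewrite -scaleN1r minkZl mulN1r. Qed.

Lemma minkNr W U : mink W (- U) = - mink W U.
Proof. by rewrite minkC minkNl (minkC W). Qed.

Lemma mink_sumr W (I : finType) (F : I -> 'rV_(1 + (1 + n))) :
  mink W (\sum_i F i) = \sum_i mink W (F i).
Proof.
apply: (big_morph (mink W) (minkDr W)).
by rewrite -(scale0r 0) minkZr mul0r.
Qed.

(** The covector of [U] under [mink]; it turns Lorentz products into matrix products. *)
Definition flat U := lvec (- cocurv U / 2) (- curv U / 2) (cen U).

Lemma mink_flat U V : mink U V = (U *m (flat V)^T) 0 0.
Proof.
rewrite -[U]lvec_eta -[V]lvec_eta mink_lvec /flat !lvecK /lvec.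
have addE (A B : 'M[R]_1) : (A + B) 0 0 = A 0 0 + B 0 0 by rewrite mxE.
rewrite !tr_row_mx !mul_row_col !addE -!dot_mulmx.
by rewrite /dot !big_ord1 !mxE !mulr1n; field.
Qed.

(* The lightlike vector of a point of the compactified space. *)
Definition pvec (p : option 'rV[R]_n) :=
  if p is Some x then lvec 1 (dot x x) x else lvec 0 1 0.

Lemma pvec_None U : mink U (pvec None) = - curv U / 2.
Proof. by rewrite -[U]lvec_eta mink_lvec lvecK dot0r; ring. Qed.

(* The sphere through x with unit normal N at x and curvature b. *)
Definition sphere_at x N b := lvec b (2 * dot N x + b * dot x x) (N + b *: x).

(** Incidence with x fixes c = 2 <m, x> - b |x|^2. With N = m - b x, the square |N|^2 then collapses
    to |m|^2 - b c = 1. *)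
Lemma sphere_atP U x : mink U U = 1 -> mink U (pvec (Some x)) = 0 ->
  exists2 N, dot N N = 1 & U = sphere_at x N (curv U).
Proof.
rewrite -[U]lvec_eta; move: (curv U) (cocurv U) (cen U) => b c m.
rewrite !mink_lvec curvK => U1 Ux.
have cE : c = 2 * dot m x - b * dot x x by lra.
exists (m - b *: x).
  by rewrite !dotE (dotC x m) -{}U1 cE; field.
by rewrite /sphere_at subrK !dotE; congr lvec; rewrite cE; ring.
Qed.

Lemma mink_sphere_at x N b N' b' :
  mink (sphere_at x N b) (sphere_at x N' b') = dot N N'.
Proof. by rewrite mink_lvec !dotE (dotC x N'); field. Qed.

Lemma mink_sphere_at_point x N b y :
  mink (sphere_at x N b) (pvec (Some (x + y))) = dot N y - b * dot y y / 2.
Proof. by rewrite mink_lvec !dotE (dotC x y); field. Qed.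

(** * Tangent spheres with disjoint interiors *)

Section Tangent.
Variables U V : 'rV[R]_(1 + (1 + n)).
Variable p : option 'rV[R]_n.
Hypotheses (U1 : mink U U = 1) (V1 : mink V V = 1).
Hypotheses (Up : mink U (pvec p) = 0) (Vp : mink V (pvec p) = 0).
Hypothesis uniq_p : forall q,
  mink U (pvec q) = 0 -> mink V (pvec q) = 0 -> q = p.
Hypothesis disj : forall x,
  0 < mink U (pvec (Some x)) -> 0 < mink V (pvec (Some x)) -> False.

(** The product is that of the unit normals N, N' at x. If it is 1, the interiors overlap near x; if
    it is not 1 or -1, the spheres meet again. Hence N' = -N, and the normals cancel in the sum. *)
Lemma tangent_mink_Some x : p = Some x ->
  mink U V = -1 /\ exists2 l, l != 0 & U + V = l *: pvec p.
Proof.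
move=> pE; move: (Up) (Vp) uniq_p; rewrite pE => Ux Vx uniq_x.
have [N N1 UE] := sphere_atP U1 Ux; have [N' N'1 VE] := sphere_atP V1 Vx.
move: (curv U) (curv V) UE VE => b b' UE VE.
have UyE y : mink U (pvec (Some (x + y))) = dot N y - b * dot y y / 2.
  by rewrite UE mink_sphere_at_point.
have VyE y : mink V (pvec (Some (x + y))) = dot N' y - b' * dot y y / 2.
  by rewrite VE mink_sphere_at_point.
have UoE : mink U (pvec None) = - b / 2 by rewrite pvec_None UE curvK.
have VoE : mink V (pvec None) = - b' / 2 by rewrite pvec_None VE curvK.
(* After inversion in x the two spheres become the planes N.z = b/2 and
   N'.z = b'/2. *)
have no_z z : dot N z = b / 2 -> dot N' z = b' / 2 -> False.
  (* Undoing the inversion, z = 0 comes from infinity and any other z from x + z / |z|^2; both are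
     common points other than x. *)
  move=> Nz N'z; have [z0|z0] := eqVneq z 0.
    have : None = Some x by apply: uniq_x; rewrite ?UoE ?VoE;
      move: Nz N'z; rewrite z0 !dot0r; lra.
    by [].
  have zz : dot z z != 0 by rewrite dot_eq0.
  have : Some (x + (dot z z)^-1 *: z) = Some x.
    by apply: uniq_x; rewrite ?UyE ?VyE !dotE ?Nz ?N'z; field.
  move=> [] /eqP; rewrite -subr_eq0 addrC addKr scaler_eq0 invr_eq0.
  by rewrite (negbTE zz) (negbTE z0).
have [NN'|NN'] := eqVneq (dot N N') 1.
  have N'E := dot_unit_eq N1 N'1 NN'; exfalso.
  have h : 0 < 1 + `|b| + `|b'| by rewrite ltr_wpDr // ltr_wpDr.
  have hb := ler_norm b; have hb' := ler_norm b'.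
  have [nb nb'] := (normr_ge0 b, normr_ge0 b').
  (* A step of length t from x along the common normal: t - b t^2 / 2 = t^2 (1/t - b/2) is positive
     once 1/t exceeds b/2, and likewise for b'. *)
  apply: (@disj (x + (1 + `|b| + `|b'|)^-1 *: N)).
    rewrite UyE !dotE N1; set t := _^-1; have t0 : 0 < t by rewrite invr_gt0.
    rewrite (_ : _ - _ = t * t * (t^-1 - b / 2)); last by field; rewrite gt_eqF.
    by rewrite !mulr_gt0 // invrK; lra.
  rewrite VyE -N'E !dotE N1; set t := _^-1.
  have t0 : 0 < t by rewrite invr_gt0.
  rewrite (_ : _ - _ = t * t * (t^-1 - b' / 2)); last by field; rewrite gt_eqF.
  by rewrite !mulr_gt0 // invrK; lra.
have [NN''|NN''] := eqVneq (dot N N') (-1); last first.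
  by case: (dot_unit_solve (b / 2) (b' / 2) N1 N'1 NN' NN'') => z [/no_z].
split; first by rewrite UE VE mink_sphere_at.
have N'E : N' = - N.
  by apply: dot_unit_eq => //; rewrite !dotE ?N1 ?opprK // dotC NN'' opprK.
exists (b + b').
  (* If b' = -b, the two inverted planes coincide, so they share the point (b/2) N. *)
  apply/negP => /eqP bb'; apply: (no_z ((b / 2) *: N)).
    by rewrite !dotE N1; ring.
  by rewrite N'E !dotE N1 (_ : b' = - b); [ring|lra].
rewrite UE VE N'E /sphere_at lvecD lvecZ !dotE; congr lvec; try ring.
by rewrite addrACA subrr add0r -scalerDl.
Qed.

(** Both curvatures vanish, so these are hyperplanes. The same three cases for their normals apply,
    without inversion; parallel half-spaces facing the same way overlap far out along u. *)
Lemma tangent_mink_None : p = None ->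
  mink U V = -1 /\ exists2 l, l != 0 & U + V = l *: pvec p.
Proof.
move=> pE; move: (U1) (V1) (Up) (Vp) uniq_p disj; rewrite pE !pvec_None.
rewrite -[U]lvec_eta -[V]lvec_eta !curvK.
move: (curv U) (cocurv U) (cen U) (curv V) (cocurv V) (cen V).
move=> b c u b' c' u' + + b0 b'0 uni dis.
have {b0} b0 : b = 0 by lra.
have {b'0} b'0 : b' = 0 by lra.
subst b b'; rewrite !mink_lvec !(mul0r, mulr0, addr0, subr0) => u1 u'1.
have no_z z : dot u z = c / 2 -> dot u' z = c' / 2 -> False.
  move=> uz u'z; have : Some z = None :> option _.
    by apply: uni; rewrite mink_lvec ?uz ?u'z; field.
  by [].
have [uu'|uu'] := eqVneq (dot u u') 1.
  have u'E := dot_unit_eq u1 u'1 uu'; exfalso.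
  have [nc nc'] := (normr_ge0 c, normr_ge0 c').
  have hc := ler_norm c; have hc' := ler_norm c'.
  apply: (dis ((1 + `|c| + `|c'|) *: u)).
    by rewrite mink_lvec !dotE u1; lra.
  by rewrite mink_lvec -u'E !dotE u1; lra.
have [uu''|uu''] := eqVneq (dot u u') (-1); last first.
  by case: (dot_unit_solve (c / 2) (c' / 2) u1 u'1 uu' uu'') => z [/no_z].
split; first by [].
have u'E : u' = - u.
  by apply: dot_unit_eq => //; rewrite !dotE ?u1 ?opprK // dotC uu'' opprK.
exists (c + c').
  apply/negP => /eqP cc'; apply: (no_z ((c / 2) *: u)).
    by rewrite !dotE u1; ring.
  by rewrite u'E !dotE u1 (_ : c' = - c); [ring|lra].
by rewrite u'E lvecD lvecZ subrr scaler0 addr0 mulr0 mulr1.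
Qed.

Lemma tangent_mink :
  mink U V = -1 /\ exists2 l, l != 0 & U + V = l *: pvec p.
Proof.
by case pE: p => [x|]; rewrite -pE;
  [exact: tangent_mink_Some pE|exact: tangent_mink_None].
Qed.

End Tangent.

(** * The basis dual to a Descartes configuration *)

Section DualBasis.
Variable w : 'I_n.+2 -> 'rV[R]_(1 + (1 + n)).
Hypothesis n_gt0 : (0 < n)%N.
Hypothesis gram : forall i j, mink (w i) (w j) = 2 * (i == j)%:R - 1.

Definition dual_basis j := 2^-1 *: (w j - n%:R^-1 *: \sum_k w k).

Let n0 : n%:R != 0 :> R. Proof. by rewrite pnatr_eq0 -lt0n. Qed.

Lemma mink_sum j : mink (w j) (\sum_k w k) = - n%:R.
Proof.
rewrite mink_sumr; under eq_bigr do rewrite gram.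
rewrite big_split /= -mulr_sumr sumr_const card_ord (bigD1 j) //= eqxx.
rewrite big1 => [|i]; last by rewrite eq_sym => /negbTE ->.
by rewrite mulNrn -!natr1; ring.
Qed.

Lemma mink_dual_basis i j : mink (w i) (dual_basis j) = (i == j)%:R.
Proof.
by rewrite minkZr minkDr minkNr minkZr mink_sum gram; field.
Qed.

Lemma mink_dual_basis2 i j :
  mink (dual_basis i) (dual_basis j) = ((i == j)%:R - n%:R^-1) / 2.
Proof.
rewrite {1}/dual_basis minkZl minkDl minkNl minkZl mink_dual_basis.
rewrite (minkC (\sum_k _)) mink_sumr.
under [\sum_k _]eq_bigr do rewrite minkC mink_dual_basis.
rewrite (bigD1 j) //= eqxx big1 => [|k /negbTE -> //].
by rewrite addr0 mulr1 mulrC.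
Qed.

(** Duality says D F^T = 1 for square matrices of size n + 2. Hence F^T D = 1 as well, which is the
    expansion; linear independence never has to be shown separately. *)
Lemma dual_basis_expand U : U = \sum_i mink U (w i) *: dual_basis i.
Proof.
pose D := (\matrix_i dual_basis i : 'M[R]_(n.+2, 1 + (1 + n))).
pose F := (\matrix_i flat (w i) : 'M[R]_(n.+2, 1 + (1 + n))).
have mulF k (A : 'M[R]_(k, 1 + (1 + n))) i j :
    (A *m F^T) i j = mink (row i A) (w j).
  rewrite mink_flat !mxE; apply: eq_bigr => l _.
  by rewrite !mxE.
have DF : D *m F^T = 1%:M.
  apply/matrixP => i j; rewrite mulF rowK minkC mink_dual_basis mxE.
  by rewrite eq_sym.
have FD := mulmx1C DF.
rewrite -{1}[U]mulmx1 -FD mulmxA mulmx_sum_row; apply: eq_bigr => i _.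
by rewrite mulF rowK; congr (mink _ _ *: _); apply/rowP => k; rewrite mxE.
Qed.

End DualBasis.

End Minkowski.

(** * Oriented spheres as unit vectors *)

Section Spheres.
Context {R : realType} {n : nat}.
Implicit Types (S T : osphere R n) (p : option 'rV[R]_n).

(** [s] is the signed curvature, positive for the inward normal; this sign makes the interior the
    set of points with positive product. *)
Definition svec S :=
  match S with
  | OSphere c r inward _ =>
      let s := (if inward then 1 else -1) / r in
      lvec s (s * (dot c c - r ^+ 2)) (s *: c)
  | OPlane u b _ => lvec 0 (2 * b) u
  end.

Lemma svec_unit S : mink (svec S) (svec S) = 1.
Proof.
case: S => [c r inw r0|u b u1]; rewrite mink_lvec; last first.
  by rewrite enorm_unit //; ring.
have r_neq0 : r != 0 by rewrite gt_eqF.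
by rewrite !dotE; case: inw; field.
Qed.

Lemma svec_reverse S : svec (reverse S) = - svec S.
Proof.
case: S => [c r inw r0|u b u1] /=; rewrite -[RHS]scaleN1r lvecZ ?scaleN1r.
  by rewrite -scaleNr; case: inw => /=; congr lvec; try congr (_ *: _); ring.
by congr lvec; ring.
Qed.

(** Up to the factor -1/(2r) and the orientation sign, this is the power of x with respect to the
    sphere. *)
Lemma svec_sphere_point c (r : R) inw (r0 : 0 < r) (x : 'rV[R]_n) :
  mink (svec (OSphere c inw r0)) (pvec (Some x)) =
  (if inw then 1 else -1) / (2 * r) * (r ^+ 2 - enorm (x - c) ^+ 2).
Proof.
have r_neq0 : r != 0 by rewrite gt_eqF.
rewrite /= mink_lvec enorm_sqr !dotE (dotC x c).
by case: inw; field.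
Qed.

Lemma svec_plane_point u b (u1 : enorm u = 1) (x : 'rV[R]_n) :
  mink (svec (OPlane b u1)) (pvec (Some x)) = dot u x - b.
Proof. by rewrite mink_lvec; field. Qed.

Lemma pointsE S p : points S p <-> mink (svec S) (pvec p) = 0.
Proof.
case: S p => [c r inw r0|u b u1] [x|].
- have r_neq0 : r != 0 by rewrite gt_eqF.
  rewrite svec_sphere_point /=; split=> [->|/eqP]; first by rewrite subrr mulr0.
  rewrite !mulf_eq0 invr_eq0 mulf_eq0 pnatr_eq0 (negbTE r_neq0) /= orbF.
  rewrite (_ : _ == 0 = false) /=; last by case: inw; rewrite ?oppr_eq0 oner_eq0.
  rewrite subr_eq0 eqf_sqr => /orP[/eqP -> //|/eqP rE].
  by have := sqrtr_ge0 (dot (x - c) (x - c)); rewrite -/(enorm _); lra.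
- rewrite pvec_None curvK /=; split=> // /eqP.
  rewrite !mulf_eq0 oppr_eq0 !mulf_eq0 !invr_eq0 pnatr_eq0 (gt_eqF r0).
  by case: inw; rewrite ?oppr_eq0 oner_eq0.
- by rewrite svec_plane_point /=; split=> [->|]; lra.
- by rewrite pvec_None curvK oppr0 mul0r.
Qed.

Lemma interiorE S x : interior S x <-> 0 < mink (svec S) (pvec (Some x)).
Proof.
case: S => [c r inw r0|u b u1]; last first.
  by rewrite svec_plane_point subr_gt0.
have e0 : 0 <= enorm (x - c) by rewrite sqrtr_ge0.
have r2 : 0 < (2 * r)^-1 by rewrite invr_gt0 mulr_gt0.
rewrite svec_sphere_point; case: inw => /=.
  by rewrite mul1r pmulr_rgt0 // subr_gt0 ltr_sqr // ?nnegrE ltW.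
rewrite mulN1r mulNr oppr_gt0 pmulr_rlt0 // subr_lt0 ltr_sqr // ?nnegrE.
exact: ltW.
Qed.

Lemma separationE S T : separation S T = - mink (svec S) (svec T).
Proof.
have sdE c (r : R) inw (r0 : 0 < r) (u : 'rV[R]_n) b (u1 : enorm u = 1) :
    signed_dist inw c u b / r =
    - mink (svec (OSphere c inw r0)) (svec (OPlane b u1)).
  have r_neq0 : r != 0 by rewrite gt_eqF.
  rewrite /= mink_lvec !dotE (dotC c) /signed_dist.
  case: ltP => h; first by rewrite gtr0_norm ?subr_gt0 //; case: inw => /=; field.
  by rewrite ler0_norm ?subr_le0 //; case: inw => /=; field.
case: S T => [c r inw r0|u b u1] [c' r' inw' r'0|u' b' u'1] /=.
- have [r_neq0 r'_neq0] : r != 0 /\ r' != 0 by rewrite !gt_eqF.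
  rewrite mink_lvec enorm_sqr !dotE (dotC c' c).
  by case: inw; case: inw' => /=; field; rewrite ?r_neq0 ?r'_neq0.
- by rewrite (sdE _ _ _ r0 _ _ u'1).
- by rewrite minkC (sdE _ _ _ r'0 _ _ u1).
- rewrite mink_lvec /angle u1 u'1 mulr1 divr1 acosK; first by field.
  by rewrite in_itv /= dot_unit_bound ?enorm_unit.
Qed.

(** For b = 0 the unit condition reads |m| = 1, giving a plane. Otherwise the centre is m / b, the
    radius 1 / |b|, and the sign of b gives the orientation. *)
Lemma svec_surj V : mink V V = 1 -> exists S, svec S = V.
Proof.
rewrite -[V]lvec_eta; move: (curv V) (cocurv V) (cen V) => b c m.
rewrite mink_lvec => V1; have [b0|b0] := eqVneq b 0.
  have m1 : enorm m = 1.
    by rewrite /enorm (_ : dot m m = 1) ?sqrtr1 // -V1 b0; ring.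
  by exists (OPlane (c / 2) m1); rewrite /= b0; congr lvec; field.
have r0 : 0 < `|b|^-1 by rewrite invr_gt0 normr_gt0.
exists (OSphere (b^-1 *: m) (0 < b) r0).
have sE : (if 0 < b then 1 else -1) / `|b|^-1 = b.
  by rewrite invrK; case: ltP => h; rewrite ?(gtr0_norm h) ?(ler0_norm h); ring.
rewrite /= sE scalerA divff // scale1r; congr lvec.
have mE : dot m m = 1 + b * c by lra.
by rewrite !dotE exprVn real_normK ?num_real // mE; field.
Qed.

Lemma descartes_gram (C : 'I_n.+2 -> osphere R n) i j p :
  oriented_descartes C -> i != j -> tangent_at (C i) (C j) p ->
  mink (svec (C i)) (svec (C j)) = -1 /\
  exists2 l, l != 0 & svec (C i) + svec (C j) = l *: pvec p.
Proof.
move=> [_ disj] ij tan.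
have [Cip Cjp] : points (C i) p /\ points (C j) p.
  by have : [set p]%classic p by []; rewrite -tan.
have uni q : points (C i) q -> points (C j) q -> q = p.
  by move=> Ciq Cjq; have : [set p]%classic q by rewrite -tan.
move: Cip Cjp => /pointsE Cip /pointsE Cjp.
case: disj => /(_ i j ij) disj.
  apply: tangent_mink => //; try exact: svec_unit.
    by move=> q /pointsE Ciq /pointsE; apply: uni.
  move=> x /interiorE Cix /interiorE Cjx.
  by have : set0 x by rewrite -disj.
(* Reversal negates both vectors: their product is unchanged, and their sum only changes sign. *)
have [] := @tangent_mink _ _ (- svec (C i)) (- svec (C j)) p.
- by rewrite minkNl minkNr opprK svec_unit.
- by rewrite minkNl minkNr opprK svec_unit.
- by rewrite minkNl Cip oppr0.
- by rewrite minkNl Cjp oppr0.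
- move=> q; rewrite !minkNl => /eqP; rewrite oppr_eq0 => /eqP/pointsE Ciq.
  by move=> /eqP; rewrite oppr_eq0 => /eqP/pointsE; apply: uni.
- move=> x; rewrite -!svec_reverse => /interiorE Cix /interiorE Cjx.
  by have : set0 x by rewrite -disj.
rewrite minkNl minkNr opprK => ij1 [l l0 lE]; split=> //.
exists (- l); first by rewrite oppr_eq0.
by rewrite scaleNr -lE opprD !opprK.
Qed.

End Spheres.

(** * The dual spheres: existence, uniqueness and separation *)

Theorem theorem7p2 (R : realType) (n : nat) (n_ge2 : (2 <= n)%N)
    (C : 'I_n.+2 -> osphere R n) (descC : oriented_descartes C) :
  exists E : 'I_n.+2 -> osphere R n,
    (forall j, is_dual C j (points (E j))) /\
    equiseparated E /\
    (forall j k, j != k -> separation (E j) (E k) = 1 / (n%:R - 1)).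
Proof.
have n_gt0 : (0 < n)%N by apply: ltn_trans n_ge2.
have n0 : n%:R != 0 :> R by rewrite pnatr_eq0 -lt0n.
have n1 : 0 < n%:R - 1 :> R by rewrite subr_gt0 ltr1n.
pose w i := svec (C i).
have gram i j : mink (w i) (w j) = 2 * (i == j)%:R - 1.
  have [<-|ij] := eqVneq i j; first by rewrite svec_unit /=; ring.
  have [p tan] := descC.1.1 i j ij.
  by rewrite (descartes_gram descC ij tan).1 /=; ring.
(* Each dual basis vector has square (1 - 1/n)/2 = (n - 1)/(2n), positive as n >= 2; [a] rescales it
   to a unit vector. *)
pose a : R := Num.sqrt (2 * n%:R / (n%:R - 1)).
have a2 : a * a = 2 * n%:R / (n%:R - 1).
  by rewrite -expr2 sqr_sqrtr // divr_ge0 ?mulr_ge0 // ltW.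
have a0 : a != 0 by rewrite gt_eqF // sqrtr_gt0 divr_gt0 ?mulr_gt0 ?ltr0n.
have dualE j k : mink (a *: dual_basis w j) (a *: dual_basis w k) =
    (n%:R * (j == k)%:R - 1) / (n%:R - 1).
  rewrite minkZl minkZr mulrA a2 mink_dual_basis2 //.
  by field; rewrite n0 gt_eqF.
have /fin_all_exists[E svecE] :
    forall j, exists S : osphere R n, svec S = a *: dual_basis w j.
  move=> j; apply: svec_surj; rewrite dualE eqxx mulr1 divff //.
  by rewrite gt_eqF.
have sep j k : j != k -> separation (E j) (E k) = 1 / (n%:R - 1).
  by move=> /negbTE jk; rewrite separationE !svecE dualE jk mulr0 sub0r mulNr opprK.
exists E; split; last by split=> // i j k l ij kl; rewrite !sep.
move=> j; split.
  split; first by exists (E j).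
  move=> i k p ij kj ik tan; apply/pointsE; rewrite svecE minkZl.
  have [_ [l l0 lE]] := descartes_gram descC ik tan.
  have : mink (dual_basis w j) (w i + w k) = 0.
    rewrite minkDr !(minkC (dual_basis w j)) !mink_dual_basis //.
    by rewrite (negbTE ij) (negbTE kj) addr0.
  rewrite lE minkZr => /eqP; rewrite mulf_eq0 (negbTE l0) => /eqP ->.
  by rewrite mulr0.
(* Uniqueness: the vector of any sphere through the tangency points is a nonzero multiple of the
   j-th dual basis vector. *)
move=> A [[S ->] through].
have sum0 i k : i != j -> k != j -> i != k ->
    mink (svec S) (w i) + mink (svec S) (w k) = 0.
  move=> ij kj ik; have [p tan] := descC.1.1 i k ik.
  have [_ [l _ lE]] := descartes_gram descC ik tan.
  by rewrite -minkDr lE minkZr (pointsE S p).1 ?mulr0 //; apply: through tan.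
(* As n + 2 >= 4, there are two further indices k and l. The products with w_i, w_k, w_l have
   vanishing pairwise sums, so each is zero. *)
have orth i : i != j -> mink (svec S) (w i) = 0.
  move=> ij; have : (1 < #|~: [set i; j]|)%N.
    by rewrite -(leq_add2l #|[set i; j]|) cardsC card_ord cards2 ij addn2.
  case/card_gt1P => k [l []]; rewrite !inE !negb_or.
  move=> /andP[ki kj] /andP[li lj] kl.
  have := sum0 i k ij kj; have := sum0 i l ij lj; have := sum0 k l kj lj kl.
  by rewrite ![i == _]eq_sym => h1 /(_ li) h2 /(_ ki) h3; lra.
have SE : svec S = mink (svec S) (w j) *: dual_basis w j.
  rewrite {1}(dual_basis_expand n_gt0 gram (svec S)) (bigD1 j) //= big1 ?addr0 //.
  by move=> i /orth ->; rewrite scale0r.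
move: (mink _ (w j)) SE => t SE.
(* A zero multiple would contradict that [svec S] is a unit vector. *)
have t0 : t != 0.
  apply: contra_eq_neq (svec_unit S) => t0.
  by rewrite SE t0 minkZl mul0r eq_sym oner_eq0.
apply/seteqP; split=> p /pointsE h; apply/pointsE; move: h;
  rewrite SE svecE !minkZl => /eqP; rewrite mulf_eq0 ?(negbTE a0) ?(negbTE t0);
  by move=> /eqP ->; rewrite mulr0.
Qed.
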